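(* Given positive integers $0<a<b$ and $m\ge 2$, let $\mathbf{r}=(m,m+a,m+b)$ and let $S(\mathbf{r})$ be the generic semigroup adapted to $\mathbf{r}$. Suppose $f_1,f_2,f_3$ are generic power series in $t$ with $v_t(f_1)=m$, $v_t(f_2)=m+a$, and $v_t(f_3)=m+b$. Let $d,k$ denote nonnegative integers. (1) Whenever $bd+\binom{d+2}{2}\le m$, there is no polynomial $G(f_1,f_2,f_3)$ with valuation satisfying $$d(m+b)+\binom{d+2}{2}\le v_t(G(f_1,f_2,f_3))\le (d+1)m-1.$$ (2) $S(\mathbf{r})$ has at least $m-\left(bd+\binom{d+2}{2}\right)$ gaps in $[dm,(d+1)m]$. (3) For any $k$, we have $$g(S(\mathbf{r}))\ge m(k+1)-b\binom{k+1}{2}-\binom{k+3}{3}.$$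
   Context: $\mathbb{N}=\{0,1,2,\dots\}$. $v_t$ is the $t$-adic valuation on $\mathbb{C}[[t]]$. A gap of a numerical semigroup $S$ is an element of $\mathbb{N}\setminus S$, and the genus $g(S)$ is the number of gaps. Generic power series with $v_t(f_i)=r_i$ $(i=1,2,3)$: $f_i(t)=\sum_{n\ge r_i} a_{i,n}t^n\in\mathbb{C}[[t]]$ with fixed nonzero lowest-order coefficients $a_{i,r_i}$ and generic higher-order coefficients, i.e. the coefficients $a_{i,n}$ with $n>r_i$, $i=1,2,3$, are algebraically independent over $\mathbb{Q}(a_{1,r_1},a_{2,r_2},a_{3,r_3})$. The generic semigroup adapted to $\mathbf{r}=(r_1,r_2,r_3)$ is $S(\mathbf{r})=\{v_t(G(f_1,f_2,f_3)) : G\in\mathbb{C}[x_1,x_2,x_3],\ G(f_1,f_2,f_3)\ne 0\}$. Polynomials $G$ have complex coefficients. *)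

(* Defs.v *)
From HB Require Import structures.
From mathcomp Require Import all_boot all_order all_algebra.
From mathcomp Require Import complex mpoly finmap.
From mathcomp Require Import boolp classical_sets cardinality reals.

Set Implicit Arguments.
Unset Strict Implicit.
Unset Printing Implicit Defensive.

Import GRing.Theory.
Local Open Scope ring_scope.
Local Open Scope classical_set_scope.

(* Formal power series.  A record, rather than nat -> K itself, because functions
   into a ring already carry the pointwise product as their ring structure. *)
Record fps (K : Type) := FPS { fps_coef : nat -> K }.

Lemma fps_ext (K : Type) (f g : fps K) :
  (forall n, fps_coef f n = fps_coef g n) -> f = g.
Proof. by case: f g => [f] [g] /= fg; congr FPS; apply/funext. Qed.

HB.instance Definition _ (K : Type) := gen_eqMixin (fps K).
HB.instance Definition _ (K : Type) := gen_choiceMixin (fps K).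

Section FpsRing.
Variable K : comNzRingType.
Implicit Types f g h : fps K.

Definition fps_const (c : K) : fps K := FPS (fun n => if n is 0%N then c else 0).
Definition fps_opp f : fps K := FPS (fun n => - fps_coef f n).
Definition fps_add f g : fps K := FPS (fun n => fps_coef f n + fps_coef g n).
Definition fps_mul f g : fps K :=
  FPS (fun n => \sum_(i < n.+1) fps_coef f i * fps_coef g (n - i)).

Fact fps_addA : associative fps_add.
Proof. by move=> f g h; apply: fps_ext => n /=; rewrite addrA. Qed.
Fact fps_addC : commutative fps_add.
Proof. by move=> f g; apply: fps_ext => n /=; rewrite addrC. Qed.
Fact fps_add0 : left_id (fps_const 0) fps_add.
Proof. by move=> f; apply: fps_ext => -[|n] /=; rewrite add0r. Qed.
Fact fps_addN : left_inverse (fps_const 0) fps_opp fps_add.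
Proof. by move=> f; apply: fps_ext => -[|n] /=; rewrite addNr. Qed.

HB.instance Definition _ :=
  GRing.isZmodule.Build (fps K) fps_addA fps_addC fps_add0 fps_addN.

Let trunc n f : {poly K} := \poly_(i < n) fps_coef f i.

Let coef_mul n f g (p q : {poly K}) :
    (forall k, (k <= n)%N -> p`_k = fps_coef f k) ->
    (forall k, (k <= n)%N -> q`_k = fps_coef g k) ->
  forall k, (k <= n)%N -> (p * q)`_k = fps_coef (fps_mul f g) k.
Proof.
move=> pf qg k kn; rewrite coefM; apply: eq_bigr => i _.
by rewrite pf ?qg // ?(leq_trans (leq_subr _ _)) // (leq_trans _ kn) // -ltnS.
Qed.

Let coef_trunc n f k : (k <= n)%N -> (trunc n.+1 f)`_k = fps_coef f k.
Proof. by move=> kn; rewrite coef_poly ltnS kn. Qed.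

Fact fps_mulA : associative fps_mul.
Proof.
move=> f g h; apply: fps_ext => n; have ct := @coef_trunc n.
rewrite -(coef_mul (ct f) (coef_mul (ct g) (ct h))) //.
by rewrite -(coef_mul (coef_mul (ct f) (ct g)) (ct h)) // mulrA.
Qed.
Fact fps_mulC : commutative fps_mul.
Proof.
move=> f g; apply: fps_ext => n; have ct := @coef_trunc n.
by rewrite -(coef_mul (ct f) (ct g)) // -(coef_mul (ct g) (ct f)) // mulrC.
Qed.
Fact fps_mul1 : left_id (fps_const 1) fps_mul.
Proof.
move=> f; apply: fps_ext => n /=.
by rewrite big_ord_recl mul1r subn0 big1 ?addr0 // => i _; rewrite mul0r.
Qed.
Fact fps_mulDl : left_distributive fps_mul fps_add.
Proof.
move=> f g h; apply: fps_ext => n /=.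
by rewrite -big_split; apply: eq_bigr => i _; rewrite mulrDl.
Qed.
Fact fps_one_neq0 : fps_const 1 != 0 :> fps K.
Proof. by apply/eqP => -[] /(congr1 (@^~ 0%N))/eqP; rewrite oner_eq0. Qed.

HB.instance Definition _ := GRing.Zmodule_isComNzRing.Build (fps K)
  fps_mulA fps_mulC fps_mul1 fps_mulDl fps_one_neq0.

(* t-adic valuation; None stands for the value +oo of the zero series. *)
Definition fps_val f : option nat :=
  if pselect (exists n, fps_coef f n != 0) is left nz then Some (ex_minn nz)
  else None.

(* The series G(f_1, ..., f_n). *)
Definition fps_subst n (G : {mpoly K[n]}) (f : 'I_n -> fps K) : fps K :=
  mmap fps_const f G.

(* Since val 0 = None, the condition G(f) <> 0 is implied. *)
Definition value_set n (f : 'I_n -> fps K) : set nat :=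
  [set v | exists G : {mpoly K[n]}, fps_val (fps_subst G f) = Some v].

End FpsRing.

Section Generic.
Variable K : fieldType.

(* The subfield of K generated by A; it contains the prime field. *)
Definition gen_subfield (A : set K) : set K :=
  [set x | forall F : {pred K}, divring_closed F ->
     (forall y, A y -> y \in F) -> x \in F].

(* For an arbitrary, possibly infinite, family c. *)
Definition alg_independent (L : set K) (I : Type) (c : I -> K) : Prop :=
  forall (n : nat) (s : 'I_n -> I), injective s ->
  forall P : {mpoly K[n]}, (forall u : 'X_{1..n}, L P@_u) ->
    P.@[fun j => c (s j)] = 0 -> P = 0.

Definition generic_series n (r : n.-tuple nat) (f : 'I_n -> fps K) : Prop :=
  (forall i, fps_val (f i) = Some (tnth r i)) /\
  alg_independent
    (gen_subfield [set fps_coef (f i) (tnth r i) | i in [set: 'I_n]])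
    (fun p : {p : 'I_n * nat | (tnth r p.1 < p.2)%N} =>
       fps_coef (f (sval p).1) (sval p).2).

End Generic.

Definition gaps (S : set nat) : set nat := ~` S.

(* fset_set is empty on infinite sets, so an infinite set of gaps would give 0. *)
Definition genus (S : set nat) : nat := #|` fset_set (gaps S)|.

Definition gaps_between (S : set nat) (x y : nat) : nat :=
  #|` fset_set (gaps S `&` [set n | (x <= n <= y)%N])|.

(* Main.v *)
From HB Require Import structures.
Require Import Defs.
From mathcomp Require Import all_boot all_order all_algebra zify.
From mathcomp Require Import complex mpoly finmap.
From mathcomp Require Import boolp classical_sets cardinality reals.

(** Every f_i has order at least m, so a monomial of degree e in
    f_1, f_2, f_3 has valuation at least e m, while only 'C(e + 2, 2) monomials
    have degree e.  Suppose that G(f_1, f_2, f_3) vanishes up to order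
    d (m + b) + 'C(d + 2, 2).  Its coefficients of degree e <= d are killed by
    induction on e.  The coefficients of t^n for n in the window
    e (m + b) <= n < e (m + b) + 'C(e + 2, 2) receive nothing from degrees below
    e, by induction, and nothing from degrees above e, since
    b e + 'C(e + 2, 2) <= m places the window below (e + 1) m.  So they form a
    square linear system in the coefficients of G of degree e, which is
    invertible by [generic_monomials_det].  Hence only degrees above d remain
    ([forced_vanishing]), and G(f_1, f_2, f_3) has valuation at least (d + 1) m.

    The determinant of that system is a polynomial in the coefficients of the
    f_i.  By algebraic independence it is nonzero as soon as it is nonzero for
    one choice of series with the same lowest terms ([generic_det_neq0]).  A good
    choice adds the same large multiple of t^(m + b) and of t^(m + b) (1 + t) to
    the lowest terms of f_1 and f_2, and takes a constant times
    t^(m + b) (1 + t)^(e + 1) for f_3.  To leading order in the multiplier the monomials become powers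
    of 1 + t with pairwise distinct exponents, and the determinant becomes one of
    binomial coefficients, nonzero by interpolation ([det_binomial]).

    This gives m - (b d + 'C(d + 2, 2)) consecutive gaps between d m and
    (d + 1) m; the genus bound is their sum over d <= k, provided that there are
    finitely many gaps.  For this, a combination of f_1^(m + a) and f_2^m cancels
    the common lowest term, and by genericity it has valuation exactly
    m (m + a) + 1, which is coprime to the value m ([finite_gaps]). *)

Set Implicit Arguments.
Unset Strict Implicit.
Unset Printing Implicit Defensive.

Import GRing.Theory Num.Theory.
Local Open Scope ring_scope.

(** * Power series: vanishing order and substitution *)

Section FpsTheory.
Variable A : comNzRingType.
Implicit Types f g : fps A.

Lemma fps_constB : zmod_morphism (@fps_const A).
Proof. by move=> x y; apply: fps_ext => -[|n] //=; rewrite subr0. Qed.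

Lemma fps_coef_constM c g n : fps_coef (fps_const c * g) n = c * fps_coef g n.
Proof. by rewrite /= big_ord_recl subn0 big1 ?addr0 // => i _; rewrite mul0r. Qed.

Lemma fps_const_monoid : monoid_morphism (@fps_const A).
Proof.
split=> // x y; apply: fps_ext => n; rewrite fps_coef_constM.
by case: n => [|n] //=; rewrite mulr0.
Qed.

HB.instance Definition _ := GRing.isZmodMorphism.Build A (fps A) (@fps_const A) fps_constB.
HB.instance Definition _ := GRing.isMonoidMorphism.Build A (fps A) (@fps_const A) fps_const_monoid.

Definition fps_of_poly (p : {poly A}) : fps A := FPS (fun k => p`_k).

Lemma fps_of_polyB : zmod_morphism fps_of_poly.
Proof. by move=> p q; apply: fps_ext => n /=; rewrite coefB. Qed.

Lemma fps_of_poly_monoid : monoid_morphism fps_of_poly.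
Proof.
split=> [|p q]; apply: fps_ext => n; last by rewrite /= coefM.
by rewrite /= coef1; case: n.
Qed.

HB.instance Definition _ :=
  GRing.isZmodMorphism.Build {poly A} (fps A) fps_of_poly fps_of_polyB.
HB.instance Definition _ :=
  GRing.isMonoidMorphism.Build {poly A} (fps A) fps_of_poly fps_of_poly_monoid.

Lemma fps_coef_sum I (r : seq I) (P : pred I) (F : I -> fps A) n :
  fps_coef (\sum_(i <- r | P i) F i) n = \sum_(i <- r | P i) fps_coef (F i) n.
Proof. by apply: (big_morph (fun f => fps_coef f n)) => //; case: n. Qed.

Definition low_zero p f := forall k, (k < p)%N -> fps_coef f k = 0.

Lemma low_zero_le p q f : (q <= p)%N -> low_zero p f -> low_zero q f.
Proof. by move=> qp f0 k kq; apply/f0/(leq_trans kq). Qed.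

Lemma low_zeroM p q f g : low_zero p f -> low_zero q g ->
  low_zero (p + q) (f * g) /\ fps_coef (f * g) (p + q) = fps_coef f p * fps_coef g q.
Proof.
move=> f0 g0; split=> [k kpq|] /=.
  rewrite big1 // => i _; case: (ltnP i p) => [/f0->|pi]; first by rewrite mul0r.
  by rewrite (g0 (k - i)%N) ?mulr0 //; have := ltn_ord i; lia.
have pS : (p < (p + q).+1)%N by rewrite ltnS leq_addr.
rewrite (bigD1 (Ordinal pS)) //= addKn big1 ?addr0 // => i; rewrite -val_eqE /= => ip.
case: (ltngtP i p) => [/f0->|pi|/eqP]; rewrite ?mul0r ?(negPf ip) //.
by rewrite (g0 (p + q - i)%N) ?mulr0 //; have := ltn_ord i; lia.
Qed.

Lemma low_zeroX p f k : low_zero p f -> low_zero (k * p) (f ^+ k).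
Proof.
move=> f0; elim: k => [|k IH]; first by move=> k.
by rewrite exprS mulSn; case: (low_zeroM f0 IH).
Qed.

Lemma low_zero_prodX n p (f : 'I_n -> fps A) (u : 'I_n -> nat) :
  (forall i, low_zero p (f i)) -> low_zero ((\sum_i u i) * p) (\prod_i f i ^+ u i).
Proof.
move=> f0; elim/big_ind2: _ => [k //|j1 g1 j2 g2 g10 g20|i _]; last exact: low_zeroX.
by rewrite mulnDl; case: (low_zeroM g10 g20).
Qed.

Lemma fps_valP f v : fps_val f = Some v <-> low_zero v f /\ fps_coef f v != 0.
Proof.
rewrite /fps_val; case: pselect => [nz|z]; last first.
  by split=> // -[_ fv]; case: z; exists v.
case: ex_minnP => w fw wmin; split=> [[<-]|[f0 fv]].
  by split=> // k kw; apply/eqP; apply: contraLR kw => /wmin; rewrite -leqNgt.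
congr Some; apply/eqP; rewrite eqn_leq wmin //= leqNgt.
by apply: contra fw => /f0 ->.
Qed.

Lemma fps_substX n (u : 'X_{1..n}) (f : 'I_n -> fps A) :
  fps_subst 'X_[u] f = \prod_i f i ^+ u i.
Proof. by rewrite /fps_subst mmapX. Qed.

Lemma low_zero_subst n p e (G : {mpoly A[n]}) (f : 'I_n -> fps A) :
  (forall i, low_zero p (f i)) -> (forall u, (mdeg u < e)%N -> G@_u = 0) ->
  low_zero (e * p) (fps_subst G f).
Proof.
move=> f0 G0 k ke; rewrite fps_coef_sum big1 // => u _; rewrite fps_coef_constM.
case: (ltnP (mdeg u) e) => [/G0 ->|eu]; first by rewrite mul0r.
rewrite (low_zero_prodX (u := u) f0) ?mulr0 // -mdegE (leq_trans ke) //.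
by rewrite leq_mul2r eu orbT.
Qed.

End FpsTheory.

(** * Subrings given by a Prop-valued predicate *)

Section Subring.
Variable A : nzRingType.

(** The Prop-valued form of [subring_closed]: the subfield generated by a set of
    elements has no boolean membership. *)
Definition subring_prop (S : A -> Prop) :=
  [/\ S 1, forall x y, S x -> S y -> S (x - y) & forall x y, S x -> S y -> S (x * y)].

Variable S : A -> Prop.
Hypothesis Ssub : subring_prop S.

Lemma subring_prop0 : S 0.
Proof. by case: Ssub => S1 SB _; rewrite -(subrr 1); apply: SB. Qed.

Lemma subring_propD x y : S x -> S y -> S (x + y).
Proof.
case: Ssub => _ SB _ Sx Sy; rewrite -[y]opprK -[- y]sub0r.
by apply: (SB) => //; apply: (SB) => //; apply: subring_prop0.
Qed.

Lemma subring_prop_sum I (r : seq I) (P : pred I) (F : I -> A) :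
  (forall i, P i -> S (F i)) -> S (\sum_(i <- r | P i) F i).
Proof. by move=> SF; apply: big_ind => //; [apply: subring_prop0|apply: subring_propD]. Qed.

Lemma subring_prop_prod I (r : seq I) (P : pred I) (F : I -> A) :
  (forall i, P i -> S (F i)) -> S (\prod_(i <- r | P i) F i).
Proof. by case: Ssub => S1 _ SM SF; apply: big_ind. Qed.

Lemma subring_propX x k : S x -> S (x ^+ k).
Proof.
case: Ssub => S1 _ SM Sx; elim: k => [|k IH]; first by rewrite expr0.
by rewrite exprS; apply: SM.
Qed.

End Subring.

Lemma subring_prop_det (A : comNzRingType) (S : A -> Prop) n (M : 'M[A]_n) :
  subring_prop S -> (forall i j, S (M i j)) -> S (\det M).
Proof.
move=> Ssub SM; apply: (subring_prop_sum Ssub) => s _.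
have [S1 SB SMul] := Ssub; apply: (SMul); last exact: subring_prop_prod.
by apply: subring_propX => //; rewrite -sub0r; apply: SB => //; exact: subring_prop0.
Qed.

Lemma subring_prop_gen_subfield (K : fieldType) (A : set K) :
  subring_prop (gen_subfield A).
Proof.
split=> [F [] //|x y Fx Fy F Fdiv AF|x y Fx Fy F Fdiv AF].
  by case: (Fdiv) => _ FB _; apply: FB; [apply: Fx|apply: Fy].
by case: (GRing.divring_closedBM Fdiv) => _ _ FM; apply: FM; [apply: Fx|apply: Fy].
Qed.

Lemma subring_prop_mpoly (K : comNzRingType) n (S : K -> Prop) :
  subring_prop S -> subring_prop (fun p : {mpoly K[n]} => forall u, S p@_u).
Proof.
move=> Ssub; have [S1 SB SM] := Ssub; split=> [u|p q Sp Sq u|p q Sp Sq u].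
- by rewrite mcoeff1; case: eqP => _ //; apply: subring_prop0.
- by rewrite mcoeffB; apply: SB.
- by rewrite mcoeffM; apply: subring_prop_sum => // i _; apply: SM.
Qed.

Lemma subring_prop_fps (A : comNzRingType) (S : A -> Prop) :
  subring_prop S -> subring_prop (fun f : fps A => forall k, S (fps_coef f k)).
Proof.
move=> Ssub; have [S1 SB SM] := Ssub; split=> [[|k]|f g Sf Sg k|f g Sf Sg k] //=.
- exact: subring_prop0.
- by apply: SB.
- by apply: subring_prop_sum => // i _; apply: SM.
Qed.

(** * Comparing power series over two rings up to a given order *)

Section Agree.
Variables (A B : comNzRingType) (phi : {rmorphism A -> B}) (T : nat).

(** The comparison stops at order T because finitely many indeterminates can
    only represent finitely many coefficients of a series. *)
Definition agree (F : fps A) (f : fps B) :=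
  forall k, (k < T)%N -> phi (fps_coef F k) = fps_coef f k.

Lemma agree1 : agree 1 1.
Proof. by case=> [|k] _ /=; rewrite ?rmorph1 ?rmorph0. Qed.

Lemma agreeM F G f g : agree F f -> agree G g -> agree (F * G) (f * g).
Proof.
move=> Ff Gg k kT /=; rewrite rmorph_sum; apply: eq_bigr => i _.
rewrite rmorphM Ff ?Gg // ?(leq_ltn_trans (leq_subr _ _)) //.
by apply: leq_trans kT.
Qed.

Lemma agree_prodX n (F : 'I_n -> fps A) (f : 'I_n -> fps B) (u : 'I_n -> nat) :
  (forall i, agree (F i) (f i)) ->
  agree (\prod_i F i ^+ u i) (\prod_i f i ^+ u i).
Proof.
move=> Ff; elim/big_ind2: _ => [|F1 f1 F2 f2|i _].
- exact: agree1.
- exact: agreeM.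
- elim: (u i) => [|k IH]; first by rewrite !expr0; exact: agree1.
  by rewrite !exprS; apply: agreeM.
Qed.

End Agree.

(** * Genericity: one good specialization is enough *)

Section Genericity.
Variable K : fieldType.

(** The determinant is P(x) for a single polynomial P, whose indeterminates stand
    for the coefficients of the series above the lowest ones and whose
    coefficients lie in the field generated by the lowest ones.  If P vanishes at
    the generic point then P = 0 by algebraic independence, so it also vanishes
    at the coefficients of f'. *)
Lemma generic_det_neq0 n (r : n.-tuple nat) (f f' : 'I_n -> fps K) N
    (u : 'I_N -> 'I_n -> nat) (e : 'I_N -> nat) :
  generic_series r f ->
  (forall i k, (k <= tnth r i)%N -> fps_coef (f' i) k = fps_coef (f i) k) ->
  \det (\matrix_(l, j) fps_coef (\prod_i f' i ^+ u j i) (e l)) != 0 ->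
  \det (\matrix_(l, j) fps_coef (\prod_i f i ^+ u j i) (e l)) != 0.
Proof.
case=> fval indep f'f.
have f0 i k : (k < tnth r i)%N -> fps_coef (f i) k = 0.
  by have [ri0 _] := (fps_valP _ _).1 (fval i); apply: ri0.
pose T := (\max_l e l).+1.
have eT l : (e l < T)%N by rewrite ltnS (leq_bigmax l).
(* Only the coefficients of order less than T enter the determinant. *)
have [V [ix [ixI ixS]]] : exists V (ix : 'I_V -> {p : 'I_n * nat | (tnth r p.1 < p.2)%N}),
    injective ix /\ forall p, ((sval p).2 < T)%N -> exists j, ix j = p.
  pose J := {p : 'I_n * 'I_T | (tnth r p.1 < p.2)%N}.
  exists #|{: J}|, (fun j => let p := enum_val j in
    exist _ ((val p).1, nat_of_ord (val p).2) (valP p)); split.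
    move=> j1 j2 [] e1 e2; apply: enum_val_inj; apply: val_inj.
    by rewrite [LHS]surjective_pairing [RHS]surjective_pairing e1; congr pair; apply: val_inj.
  case=> [[i k] /= kr] kT; exists (enum_rank (exist _ (i, Ordinal kT) kr : J)).
  by apply: val_inj; rewrite /= enum_rankK.
(* The lowest coefficients stay constants, because the independence is over the
   field that they generate. *)
pose F i : fps {mpoly K[V]} := FPS (fun k =>
  if k == tnth r i then (fps_coef (f i) k)%:MP
  else \sum_(j | sval (ix j) == (i, k)) 'X_j).
have Fagree (g : 'I_n -> fps K) :
    (forall i k, (k <= tnth r i)%N -> fps_coef (g i) k = fps_coef (f i) k) ->
  forall i, agree (meval (fun j => fps_coef (g (sval (ix j)).1) (sval (ix j)).2)) T (F i) (g i).
  move=> gf i k kT /=; case: eqP => [->|/eqP kr]; first by rewrite mevalC gf.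
  rewrite raddf_sum /=; case: (ltngtP k (tnth r i)) kr => // kr _.
    rewrite big1 => [|j /eqP jE]; first by rewrite gf ?f0 // ltnW.
    by case: (ix j) jE => /= p pr pE; move: pr; rewrite pE /= ltnNge (ltnW kr).
  have [j0 j0E] := ixS (exist _ (i, k) kr) kT.
  rewrite (big_pred1 j0) => [|j]; first by rewrite mevalXU j0E.
  by rewrite /= -(inj_eq ixI) -(inj_eq val_inj) /= j0E.
pose P := \det (\matrix_(l, j) fps_coef (\prod_i F i ^+ u j i) (e l)).
have Peval (g : 'I_n -> fps K) :
    (forall i k, (k <= tnth r i)%N -> fps_coef (g i) k = fps_coef (f i) k) ->
  P.@[fun j => fps_coef (g (sval (ix j)).1) (sval (ix j)).2] =
  \det (\matrix_(l, j) fps_coef (\prod_i g i ^+ u j i) (e l)).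
  move=> gf; rewrite -det_map_mx; congr (\det _); apply/matrixP => l j; rewrite !mxE.
  by apply: (agree_prodX (u j) (Fagree g gf)).
rewrite -(Peval _ f'f) -(Peval f) //; apply: contraNneq => P0.
rewrite (indep _ ix ixI P _ P0) ?meval0 //.
(* The polynomial P has its coefficients in the field of lowest coefficients. *)
have Lsub := subring_prop_gen_subfield
  [set fps_coef (f i) (tnth r i) | i in [set: 'I_n]]%classic.
have PLsub := subring_prop_mpoly V Lsub.
apply: (subring_prop_det PLsub) => l j; rewrite mxE; move: (e l).
have FLsub := subring_prop_fps PLsub.
apply: (subring_prop_prod FLsub) => i _; apply: (subring_propX FLsub) => k /=.
case: eqP => [-> v|_]; last first.
  apply: (subring_prop_sum PLsub) => h _ v; rewrite mcoeffX.
  by case: eqP => _; [case: Lsub | exact: subring_prop0].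
rewrite mcoeffC; case: Lsub => S1 _ SM; apply: SM.
  by move=> E _ AE; apply: AE; exists i.
by case: eqP => _ //; exact: (subring_prop0 (subring_prop_gen_subfield _)).
Qed.

End Genericity.

(** * The determinant at a special triple of series *)

Lemma horner_prod_XsubC_nat (A : comNzRingType) l k :
  (\prod_(i < l) ('X - i%:R%:P)).[k%:R] = (k ^_ l)%:R :> A.
Proof.
elim: l => [|l IH]; first by rewrite big_ord0 hornerC ffactn0.
rewrite big_ord_recr /= hornerM IH !hornerE ffactnSr natrM.
by case: (leqP l k) => kl; [rewrite natrB | rewrite ffact_small // !mul0r].
Qed.

(** A linear relation between the rows is a polynomial Q, written in the basis of
    the binomials 'C(X, l) with l < N, that vanishes at the N points k t.  Hence
    Q = 0, and evaluating Q at 0, 1, 2, ... gives its coordinates one by one. *)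
Lemma det_binomial (K : numFieldType) N (k : 'I_N -> nat) :
  injective k -> \det (\matrix_(l < N, t < N) 'C(k t, l)%:R : 'M[K]_N) != 0.
Proof.
move=> kI; apply/det0P => -[w /negP wn0 wM]; apply: wn0; apply/eqP/rowP => l0.
pose Q := \sum_(l < N) (w 0 l / (l`!)%:R) *: \prod_(i < l) ('X - i%:R%:P).
have Qk n : Q.[n%:R] = \sum_(l < N) w 0 l * 'C(n, l)%:R.
  rewrite /Q horner_sum; apply: eq_bigr => l _.
  rewrite hornerZ horner_prod_XsubC_nat -bin_ffact natrM mulrAC -mulrA.
  by rewrite mulfK // pnatr_eq0 -lt0n fact_gt0.
have Q0 : Q = 0.
  apply: (@roots_geq_poly_eq0 _ _ [seq (k t)%:R | t <- enum 'I_N]).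
  - apply/allP => _ /mapP[t _ ->]; apply/rootP; rewrite Qk.
    have /rowP/(_ t) := wM; rewrite !mxE => wt; rewrite -[RHS]wt.
    by apply: eq_bigr => l _; rewrite mxE.
  - rewrite map_inj_uniq ?enum_uniq // => t1 t2 /eqP.
    by rewrite eqr_nat => /eqP/kI.
  - rewrite size_map size_enum_ord; apply: (leq_trans (size_sum _ _ _)).
    apply/bigmax_leqP => l _; apply: (leq_trans (size_scale_leq _ _)).
    by rewrite size_prod_XsubC /index_enum -enumT size_enum_ord.
rewrite mxE; have [n] := ubnP l0; elim: n l0 => // n IH l0 /ltnSE ln.
(* 'C(l0, l) = 0 for l > l0, and the coordinates before l0 are zero already. *)
have := Qk l0; rewrite Q0 horner0 (bigD1 l0) //= binn mulr1 big1 ?addr0 // => l ll0.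
have [lt|gt|/val_inj eq] := ltngtP l l0; last by rewrite eq eqxx in ll0.
  by rewrite IH ?mul0r // (leq_trans lt).
by rewrite bin_small // mulr0.
Qed.

Lemma det_scale_cols (A : comNzRingType) N (M : 'I_N -> 'I_N -> A) (s : 'I_N -> A) :
  \det (\matrix_(l, t) (s t * M l t)) = \det (\matrix_(l, t) M l t) * \prod_t s t.
Proof.
have -> : \prod_t s t = \det (diag_mx (\row_t s t)).
  by rewrite det_diag; apply: eq_bigr => t _; rewrite mxE.
by rewrite -det_mulmx mul_mx_diag; congr (\det _); apply/matrixP => l t; rewrite !mxE mulrC.
Qed.

(** The determinant in the conclusion is a polynomial in x.  At x = 0 the common factor
    'X^e comes out of each h i, and every monomial has degree j, so that the rows
    from j * e on are those of the given determinant.  A nonzero polynomial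
    over a closed field has a nonroot other than 0. *)
Lemma exists_deformation_det_neq0 (K : closedFieldType) n (low h : 'I_n -> {poly K}) e j N
    (u : 'I_N -> 'I_n -> nat) :
  (forall t, (\sum_i u t i)%N = j) ->
  \det (\matrix_(l < N, t < N) (\prod_i h i ^+ u t i)`_l) != 0 ->
  exists2 x : K, x != 0 &
    \det (\matrix_(l < N, t < N)
      (\prod_i (x *: low i + 'X^e * h i) ^+ u t i)`_(j * e + l)) != 0.
Proof.
move=> uj hdet.
pose q i : {poly {poly K}} := 'X *: map_poly polyC (low i) + map_poly polyC ('X^e * h i).
pose D := \det (\matrix_(l < N, t < N) (\prod_i q i ^+ u t i)`_(j * e + l)).
have Dx x : D.[x] = \det (\matrix_(l < N, t < N)
      (\prod_i (x *: low i + 'X^e * h i) ^+ u t i)`_(j * e + l)).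
  rewrite -[D.[x]]/(horner_eval x D) -det_map_mx; congr (\det _).
  apply/matrixP => l t; rewrite !mxE -coef_map rmorph_prod.
  apply: (congr1 (fun p : {poly K} => p`_(j * e + l))).
  apply: eq_bigr => i _; rewrite rmorphXn rmorphD /=; congr ((_ + _) ^+ _).
    rewrite map_polyZ /= /horner_eval hornerX -map_poly_comp_id0 ?hornerC //; congr (_ *: _).
    by apply: map_poly_id => c _ /=; rewrite hornerC.
  rewrite -map_poly_comp_id0 /horner_eval ?hornerC //.
  by apply: map_poly_id => c _ /=; rewrite hornerC.
have D0 : D != 0.
  apply: contraNneq hdet => D0; apply/eqP; rewrite -[RHS](horner0 0) -D0 Dx.
  congr (\det _); apply/matrixP => l t; rewrite !mxE.
  under [in RHS]eq_bigr => i _ do rewrite scale0r add0r exprMn -exprM.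
  rewrite big_split /= prodrXr -big_distrr /= uj mulnC coefXnM.
  by rewrite ltnNge leq_addr /= addKn.
have /closed_nonrootP[x] : 'X * D != 0 by rewrite mulf_neq0 // polyX_eq0.
by rewrite rootE hornerM hornerX mulf_eq0 negb_or Dx => /andP[x0 Dx0]; exists x.
Qed.

Lemma coef_1addX_exp (A : comNzRingType) k l : ((1 + 'X) ^+ k)`_l = 'C(k, l)%:R :> A.
Proof.
elim: k l => [|k IH] l; first by rewrite expr0 coef1 bin0n.
rewrite exprS mulrDl mul1r coefD coefXM !IH; case: l => [|l]; first by rewrite !bin0 addr0.
by rewrite binS natrD.
Qed.

(** Here p i has the lowest term c i t^(r_i).  With h = (1, 1 + t, c_2 (1 + t)^(j + 1)),
    a monomial of exponents (u_0, u_1, u_2) and degree j in the h i is a constant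
    times (1 + t)^(u_1 + (j + 1) u_2).  Because u_1 <= j, this exponent
    determines the monomial, and [det_binomial] applies.  Then
    [exists_deformation_det_neq0] adds the lowest terms with a factor x, and
    dividing the first two series by x restores their lowest coefficients.  The
    third one needs no deformation, since its lowest order is m + b itself. *)
Lemma exists_specialization_det_neq0 (K : numClosedFieldType) m a b (c : 'I_3 -> K) j N
    (u : 'I_N -> 'I_3 -> nat) :
  (0 < a)%N -> (a < b)%N -> (forall i, c i != 0) ->
  (forall t, (\sum_i u t i)%N = j) ->
  (forall s t, u s =1 u t -> s = t) ->
  exists2 p : 'I_3 -> {poly K},
    forall i k, (k <= tnth [tuple m; m + a; m + b]%N i)%N ->
      (p i)`_k = if k == tnth [tuple m; m + a; m + b]%N i then c i else 0
  & \det (\matrix_(l < N, t < N) (\prod_i p i ^+ u t i)`_(j * (m + b) + l)) != 0.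
Proof.
move=> a0 ab c0 uj uI.
have uE t : (u t ord0 + u t (inord 1) + u t (inord 2) = j)%N.
  rewrite -(uj t) !big_ord_recl big_ord0 addn0 addnA.
  by congr (_ + u t _ + u t _)%N; apply: val_inj; rewrite /= inordK.
have i3 (i : 'I_3) : [\/ i = ord0, i = inord 1 | i = inord 2].
  case: i => [[|[|[|//]]] i]; [constructor 1|constructor 2|constructor 3];
  by apply: val_inj; rewrite /= ?inordK.
pose h (i : 'I_3) : {poly K} := nth 0 [:: 1; 1 + 'X; c i *: (1 + 'X) ^+ j.+1] i.
pose low (i : 'I_3) : {poly K} := nth 0 [:: c i *: 'X^m; c i *: 'X^(m + a); 0] i.
have prodE (A : comNzRingType) (F : 'I_3 -> A) :
    \prod_i F i = F ord0 * F (inord 1) * F (inord 2).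
  rewrite !big_ord_recl big_ord0 mulr1 mulrA.
  by congr (_ * F _ * F _); apply: val_inj; rewrite /= inordK.
have [] := @exists_deformation_det_neq0 K 3 low h (m + b) j N u uj.
  have -> : (\matrix_(l < N, t < N) (\prod_i h i ^+ u t i)`_l) =
      \matrix_(l < N, t < N) (c (inord 2) ^+ u t (inord 2) *
         'C(u t (inord 1) + j.+1 * u t (inord 2), l)%:R).
    apply/matrixP => l t; rewrite !mxE prodE /h /= !inordK //=.
    rewrite expr1n mul1r exprZn -exprM -scalerAr -exprD coefZ.
    by rewrite coef_1addX_exp.
  rewrite (det_scale_cols (fun l t => _)) mulf_neq0 //.
    apply: det_binomial => s t st; apply: uI => i.
    have div w : ((u w (inord 1) + j.+1 * u w (inord 2)) %/ j.+1 = u w (inord 2))%N.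
      by rewrite addnC mulnC divnMDl // divn_small ?addn0 //; have := uE w; lia.
    have u2 : u s (inord 2) = u t (inord 2) by rewrite -(div s) -(div t) st.
    have u1 : u s (inord 1) = u t (inord 1) by move: st; rewrite u2 => /addIn.
    have u0 : u s ord0 = u t ord0 by have := uE s; have := uE t; lia.
    by case: (i3 i) => ->.
  by apply/prodf_neq0 => t _; rewrite expf_neq0.
move=> x x0 xdet.
pose sc (i : 'I_3) := nth 0 [:: x^-1; x^-1; 1] i.
have sc0 i : sc i != 0.
  by rewrite /sc; case: (i3 i) => ->; rewrite /= ?inordK //= ?invr_eq0 ?oner_eq0.
exists (fun i => sc i *: (x *: low i + 'X^(m + b) * h i)).
  move=> i k; rewrite (tnth_nth 0%N) /sc /low /h coefZ coefD coefZ coefXnM.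
  case: (i3 i) => -> /=; rewrite ?inordK //= => ki.
  - rewrite coefZ coefXn (_ : k < m + b)%N ?addr0; last lia.
    by rewrite mulKf //; case: eqP => _; rewrite ?mulr1 ?mulr0.
  - rewrite coefZ coefXn (_ : k < m + b)%N ?addr0; last lia.
    by rewrite mulKf //; case: eqP => _; rewrite ?mulr1 ?mulr0.
  - rewrite coef0 mulr0 add0r mul1r; case: ltngtP ki => // -> _.
    by rewrite subnn coefZ coef_1addX_exp bin0 mulr1.
have -> : \matrix_(l < N, t < N)
     (\prod_i (sc i *: (x *: low i + 'X^(m + b) * h i)) ^+ u t i)`_(j * (m + b) + l) =
   \matrix_(l < N, t < N) ((\prod_i sc i ^+ u t i) *
     (\prod_i (x *: low i + 'X^(m + b) * h i) ^+ u t i)`_(j * (m + b) + l)).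
  apply/matrixP => l t; rewrite !mxE -coefZ -mul_polyC rmorph_prod -big_split /=.
  apply: (congr1 (fun p : {poly K} => p`_(j * (m + b) + l))).
  by apply: eq_bigr => i _; rewrite rmorphXn /= -exprMn mul_polyC.
rewrite (det_scale_cols (fun l t => _)) mulf_neq0 //.
by apply/prodf_neq0 => t _; apply/prodf_neq0 => i _; rewrite expf_neq0.
Qed.

Lemma det_mx22 (A : comNzRingType) (M : 'M[A]_2) :
  \det M = M 0 0 * M 1 1 - M 0 1 * M 1 0.
Proof.
rewrite (expand_det_row _ ord0) !big_ord_recl big_ord0 addr0 /cofactor !det_mx11 !mxE.
rewrite expr0 mul1r expr1 mulN1r mulrN.
by congr (M _ _ * M _ _ - M _ _ * M _ _); apply: val_inj.
Qed.

(** * The set of values is a monoid *)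

Section ValueSet.
Variables (K : fieldType) (n : nat) (f : 'I_n -> fps K).

Lemma value_set0 : value_set f 0%N.
Proof.
by exists 1; apply/fps_valP; rewrite /fps_subst rmorph1; split=> //=; rewrite oner_neq0.
Qed.

Lemma value_setD v w : value_set f v -> value_set f w -> value_set f (v + w)%N.
Proof.
move=> [G /fps_valP[G0 Gv]] [H /fps_valP[H0 Hw]]; exists (G * H); apply/fps_valP.
rewrite /fps_subst rmorphM; have [? ->] := low_zeroM G0 H0.
by split=> //; rewrite mulf_neq0.
Qed.

Lemma value_setMn v k : value_set f v -> value_set f (k * v)%N.
Proof.
by move=> fv; elim: k => [|k IH]; [exact: value_set0 | rewrite mulSn; exact: value_setD].
Qed.

End ValueSet.

(** * Values of polynomials in three generic series *)

Section ThreeSeries.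
Variables (K : numClosedFieldType) (m a b : nat) (f : 'I_3 -> fps K).
Hypotheses (ha : (0 < a)%N) (hab : (a < b)%N).
Hypothesis hf : generic_series [tuple m; m + a; m + b]%N f.

Let r := [tuple m; m + a; m + b]%N.
Let c i := fps_coef (f i) (tnth r i).

Let f_low i : low_zero (tnth r i) (f i).
Proof. by case: hf => fv _; case/fps_valP: (fv i). Qed.

Let c_neq0 i : c i != 0.
Proof. by case: hf => fv _; case/fps_valP: (fv i). Qed.

Let f_low_m i : low_zero m (f i).
Proof.
apply: low_zero_le (@f_low i); rewrite (tnth_nth 0%N) /=.
by case: i => [[|[|[|]]]] //= _; lia.
Qed.

Let same_lowest_terms (p : 'I_3 -> {poly K}) :
  (forall i k, (k <= tnth r i)%N -> (p i)`_k = if k == tnth r i then c i else 0) ->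
  forall i k, (k <= tnth r i)%N -> fps_coef (fps_of_poly (p i)) k = fps_coef (f i) k.
Proof.
move=> pc i k kr; rewrite /= pc //; case: eqP => [-> //|/eqP kr'].
by rewrite f_low // ltn_neqAle kr'.
Qed.

Let coef_prod_poly (p : 'I_3 -> {poly K}) (u : 'I_3 -> nat) n :
  fps_coef (\prod_i fps_of_poly (p i) ^+ u i) n = (\prod_i p i ^+ u i)`_n.
Proof.
rewrite -[RHS]/(fps_coef (fps_of_poly _) n) rmorph_prod.
by congr (fps_coef _ n); apply: eq_bigr => i _; rewrite rmorphXn.
Qed.

(** The window of rows starts at e (m + b), the largest valuation of a monomial of
    degree e, so that the special series can start all their monomials there. *)
Lemma generic_monomials_det e N (u : 'I_N -> 'X_{1..3}) :
  (forall t, mdeg (u t) = e) -> injective u ->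
  \det (\matrix_(l < N, t < N) fps_coef (\prod_i f i ^+ u t i) (e * (m + b) + l)) != 0.
Proof.
move=> ue uI.
have [|s t /mnmP/uI //|p pc pdet] :=
  @exists_specialization_det_neq0 K m a b c e N u ha hab c_neq0.
  by move=> t; rewrite -mdegE.
apply: (generic_det_neq0 (u := u) (e := fun l : 'I_N => (e * (m + b) + l)%N) hf
  (same_lowest_terms pc)).
have -> // : \matrix_(l < N, t < N)
    fps_coef (\prod_i fps_of_poly (p i) ^+ u t i) (e * (m + b) + l) =
  \matrix_(l < N, t < N) (\prod_i p i ^+ u t i)`_(e * (m + b) + l).
by apply/matrixP => l t; rewrite !mxE coef_prod_poly.
Qed.

(** By induction on the degree e: the coefficients of t^n in the window
    e (m + b) <= n < e (m + b) + 'C(e + 2, 2) involve only the part of G of degree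
    e, and they determine it. *)
Lemma forced_vanishing d v (G : {mpoly K[3]}) :
  (b * d + 'C(d + 2, 2) <= m)%N -> (d * (m + b) + 'C(d + 2, 2) <= v)%N ->
  low_zero v (fps_subst G f) -> forall u, (mdeg u < d.+1)%N -> G@_u = 0.
Proof.
move=> dm dv Gv; elim: {-2}(d.+1) (leqnn d.+1) => // e IH ed.
have {}IH := IH (ltnW ed).
have binle : ('C(e + 2, 2) <= 'C(d + 2, 2))%N by apply: leq_bin2l; lia.
have bed : (b * e <= b * d)%N by rewrite leq_mul2l; lia.
have med : (e * (m + b) <= d * (m + b))%N by rewrite leq_mul2r; lia.
(* The monomials of degree e, indexed by the compositions of e into 3 parts. *)
pose T := [set t : 3.-tuple 'I_e.+1 | (\sum_(i <- t) i)%N == e].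
have cardT : #|T| = 'C(e + 2, 2) by rewrite card_ord_partitions addnC.
pose mon (s : 'I_#|T|) : 'X_{1..3} := [multinom (tnth (enum_val s) i : nat) | i < 3].
have mon_deg s : mdeg (mon s) = e.
  have := enum_valP s; rewrite inE big_tuple => /eqP sE; rewrite -[RHS]sE mdegE.
  by apply: eq_bigr => i _; rewrite mnmE.
have mon_inj : injective mon.
  move=> s t /mnmP st; apply: enum_val_inj; apply: eq_from_tnth => i.
  by apply: val_inj; have := st i; rewrite !mnmE.
have mon_surj u : mdeg u = e -> exists s, mon s = u.
  move=> ue; pose t := [tuple inord (u i) : 'I_e.+1 | i < 3].
  have tE i : nat_of_ord (tnth t i) = u i.
    rewrite tnth_mktuple inordK // ltnS -ue mdegE (bigD1 i) //=; exact: leq_addr.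
  have tT : t \in T.
    by rewrite inE big_tuple -[X in _ == X]ue mdegE; apply/eqP/eq_bigr.
  exists (enum_rank_in tT t); apply/mnmP => i.
  by rewrite mnmE enum_rankK_in.
pose H := \sum_(s < #|T|) G@_(mon s) *: 'X_[mon s].
(* G - H has no term of degree at most e, so it does not reach the window. *)
have GH u : (mdeg u < e.+1)%N -> (G - H)@_u = 0.
  rewrite ltnS leq_eqVlt mcoeffB /H raddf_sum /= => /orP[/eqP /mon_surj[s <-]|ue].
    rewrite (bigD1 s) //= mcoeffZ mcoeffX eqxx mulr1 big1 ?addr0 ?subrr // => t ts.
    by rewrite mcoeffZ mcoeffX (inj_eq mon_inj) (negPf ts) mulr0.
  rewrite IH // big1 ?subr0 // => s _; rewrite mcoeffZ mcoeffX.
  by case: eqP => [su|]; [rewrite -su mon_deg ltnn in ue | rewrite mulr0].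
pose M := \matrix_(l < #|T|, s < #|T|)
  fps_coef (\prod_i f i ^+ mon s i) (e * (m + b) + l).
have Munit : M \in unitmx by rewrite unitmxE unitfE; apply: generic_monomials_det.
have Mw : M *m \col_s G@_(mon s) = 0.
  apply/colP => l; rewrite !mxE; have lN := ltn_ord l; rewrite {2}cardT in lN.
  have Gl : fps_coef (fps_subst G f) (e * (m + b) + l) = 0 by apply: Gv; lia.
  have GHl : fps_coef (fps_subst (G - H) f) (e * (m + b) + l) = 0.
    by apply: (low_zero_subst f_low_m GH); rewrite mulSn; lia.
  move: GHl; rewrite /fps_subst raddfB /= -/(fps_subst G f) Gl => /eqP.
  rewrite sub0r oppr_eq0 raddf_sum fps_coef_sum => /eqP Hl; rewrite -[RHS]Hl.
  apply: eq_bigr => s _; rewrite !mxE /= mmapZ fps_coef_constM mulrC.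
  by rewrite -/(fps_subst _ f) fps_substX.
have {Mw} w0 : \col_s G@_(mon s) = 0 by rewrite -[LHS](mulKmx Munit) Mw mulmx0.
move=> u; rewrite ltnS leq_eqVlt => /orP[/eqP /mon_surj[s <-]|/IH //].
by have /colP/(_ s) := w0; rewrite !mxE.
Qed.

Lemma value_gap d v : (b * d + 'C(d + 2, 2) <= m)%N ->
  (d * (m + b) + 'C(d + 2, 2) <= v < d.+1 * m)%N -> ~ value_set f v.
Proof.
move=> dm /andP[dv vd] [G /fps_valP[G0 /eqP]]; apply.
by apply: (low_zero_subst f_low_m (forced_vanishing dm dv G0)).
Qed.

Lemma value_set_lowest i : value_set f (tnth r i).
Proof.
case: hf => fv _; exists 'X_i; rewrite -(fv i) fps_substX; congr fps_val.
rewrite (bigD1 i) //= mnmE eqxx expr1 big1 ?mulr1 // => j ij.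
by rewrite mnmE eq_sym (negPf ij).
Qed.

(** The series f_1^(m + a) and f_2^m both start at order m (m + a).  Cancelling their
    lowest terms leaves, at the next order, the determinant of a 2 x 2 matrix of
    coefficients of the two series.  It is nonzero by genericity, as seen on
    series proportional to t^m (1 + t) and t^(m + a). *)
Lemma value_set_succ : (0 < m)%N -> value_set f (m * (m + a)).+1.
Proof.
move=> m0; pose o1 : 'I_3 := inord 1.
pose u (j : 'I_2) : 'X_{1..3} := if j == 0 then (U_(ord0) *+ (m + a))%MM else (U_(o1) *+ m)%MM.
pose A := \matrix_(l < 2, j < 2) fps_coef (\prod_i f i ^+ u j i) (m * (m + a) + l).
have o10 : (ord0 == o1) = false by rewrite -val_eqE /= inordK.
have prodU (R : comNzRingType) (g : 'I_3 -> R) i k :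
    \prod_j g j ^+ (U_(i) *+ k)%MM j = g i ^+ k.
  rewrite (bigD1 i) //= mulmnE mnmE eqxx mul1n big1 ?mulr1 // => j ij.
  by rewrite mulmnE mnmE eq_sym (negPf ij) mul0n.
have u0 : u 0 = (U_(ord0) *+ (m + a))%MM by [].
have u1 : u 1 = (U_(o1) *+ m)%MM by [].
have detA : \det A != 0.
  pose p (i : 'I_3) : {poly K} :=
    c i *: ('X^(tnth r i) * (1 + 'X) ^+ (i == ord0)).
  apply: (generic_det_neq0 (f' := fun i => fps_of_poly (p i)) (u := u)
    (e := fun l : 'I_2 => (m * (m + a) + l)%N) hf).
    apply: same_lowest_terms => i k kr; rewrite coefZ coefXnM coef_1addX_exp.
    case: ltngtP kr => //= [_ _|-> _].
      by rewrite mulr0.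
    by rewrite subnn bin0 mulr1.
  rewrite det_mx22 !mxE !coef_prod_poly u0 u1 !prodU /p eqxx [o1 == _]eq_sym o10 expr0 mulr1 expr1.
  rewrite !exprZn exprMn -!exprM !coefZ !coefXnM !coef_1addX_exp !coefXn.
  rewrite !(tnth_nth 0%N) /= inordK //= [((m + a) * m)%N]mulnC.
  rewrite !addn0 ltnn subnn bin0 eqxx addn1 ltnNge leqnSn /= subSnn bin1.
  rewrite (gtn_eqF (ltnSn _)) !mulr0 sub0r mulr1 oppr_eq0.
  by rewrite !mulf_neq0 ?expf_neq0 ?pnatr_eq0 ?c_neq0 //; lia.
pose G : {mpoly K[3]} := A 0 1 *: 'X_[u 0] - A 0 0 *: 'X_[u 1].
have Gc n : fps_coef (fps_subst G f) n =
    A 0 1 * fps_coef (f ord0 ^+ (m + a)) n - A 0 0 * fps_coef (f o1 ^+ m) n.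
  rewrite /fps_subst raddfB /= !mmapZ !fps_coef_constM -![mmap _ _ _]/(fps_subst _ f).
  by rewrite !fps_substX u0 u1 !prodU.
have AE l : (A l 0 = fps_coef (f ord0 ^+ (m + a)) (m * (m + a) + l)) *
            (A l 1 = fps_coef (f o1 ^+ m) (m * (m + a) + l)).
  by rewrite !mxE u0 u1 !prodU.
exists G; apply/fps_valP; split=> [k|]; rewrite Gc.
  rewrite ltnS leq_eqVlt => /orP[/eqP ->|kq].
    by rewrite !AE !addn0 mulrC subrr.
  rewrite (low_zeroX (@f_low ord0)) ?(low_zeroX (@f_low o1)) ?mulr0 ?subr0 //.
    by rewrite (tnth_nth 0%N) /= inordK.
  by rewrite mulnC.
have -> : ((m * (m + a)).+1 = m * (m + a) + (1%R : 'I_2))%N by rewrite addn1.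
move: detA; rewrite det_mx22 -!AE.
by rewrite -oppr_eq0 opprB.
Qed.

(** The value q = m (m + a) + 1 is 1 modulo m, so n is (n mod m) q plus a multiple
    of m, which is nonnegative once n >= m q. *)
Lemma finite_gaps : (0 < m)%N -> finite_set (gaps (value_set f)).
Proof.
move=> m0; apply: (@sub_finite_set _ _ `I_(m * (m * (m + a)).+1)) => [n /=|]; last exact: finite_II.
move=> nS; rewrite ltnNge; apply/negP => qn; apply: nS.
pose k := (n %/ m - n %% m * (m + a))%N.
have -> : n = (n %% m * (m * (m + a)).+1 + k * m)%N.
  have rm := ltn_pmod n m0; have nE := divn_eq n m.
  have : ((m * (m + a)).+1 <= n %/ m)%N by rewrite leq_divRL // mulnC.
  have : (n %% m * (m + a) <= m * (m + a))%N by rewrite leq_mul2r (ltnW rm) orbT.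
  by rewrite /k; nia.
apply: value_setD; apply: value_setMn; first exact: value_set_succ.
exact: (value_set_lowest ord0).
Qed.

End ThreeSeries.

(** * Counting gaps *)

Lemma size_le_card_fset_set (T : choiceType) (A : set T) (s : seq T) :
  finite_set A -> uniq s -> (forall x, x \in s -> A x) ->
  (size s <= #|` fset_set A|)%N.
Proof.
move=> finA us sA; apply: uniq_leq_size us _ => x /sA Ax.
by rewrite in_fset_set // inE.
Qed.

Section Count.
Variables (K : numClosedFieldType) (m a b : nat) (f : 'I_3 -> fps K).
Hypotheses (ha : (0 < a)%N) (hab : (a < b)%N).
Hypothesis hf : generic_series [tuple m; m + a; m + b]%N f.

(** The truncated subtraction makes the block empty when the bound on the number
    of gaps is negative, so that such d do not disturb the sum over all d. *)
Definition gap_block d :=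
  iota (d * (m + b) + 'C(d + 2, 2)) (m - (b * d + 'C(d + 2, 2))).

Lemma gap_blockP d n : n \in gap_block d ->
  gaps (value_set f) n /\ (d * m <= n < d.+1 * m)%N.
Proof.
rewrite mem_iota => /andP[n1 n2].
have dmb : (d * (m + b) = d * m + b * d)%N by rewrite mulnDr [(b * d)%N]mulnC.
have nd : (n < d.+1 * m)%N by rewrite mulSn; lia.
split; last by lia.
by apply: (value_gap ha hab hf (d := d)); rewrite ?n1 ?nd //; lia.
Qed.

(** The blocks for d < n are disjoint, since the block for d lies in
    [d m, (d + 1) m); their sizes add up by the Pascal rule
    for 'C(n, 2) and 'C(n + 2, 3). *)
Lemma gap_blocks n : exists s : seq nat,
  [/\ uniq s, forall v, v \in s -> gaps (value_set f) v /\ (v < n * m)%N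
    & (m * n <= size s + b * 'C(n, 2) + 'C(n + 2, 3))%N].
Proof.
elim: n => [|n [s [us sg sn]]]; first by exists [::]; split=> //; rewrite muln0.
exists (s ++ gap_block n); split.
- rewrite cat_uniq us iota_uniq andbT /=; apply/hasPn => v /gap_blockP[_ vn].
  by apply/negP => /sg[_]; lia.
- move=> v; rewrite mem_cat => /orP[/sg[vg vn]|/gap_blockP[vg /andP[_ vn]]]; split=> //.
  by rewrite mulSn; lia.
- by rewrite size_cat size_iota addSn [in 'C(n.+1, 2)]binS [in X in (_ <= X)%N]binS bin1; lia.
Qed.

End Count.

Theorem proposition2p6 (R : realType) (m a b : nat) (f : 'I_3 -> fps R[i])
    (ha : (0 < a)%N) (hab : (a < b)%N) (hm : (2 <= m)%N)
    (hf : generic_series [tuple m; (m + a)%N; (m + b)%N] f) :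
  [/\ forall d : nat, (b * d + 'C(d + 2, 2) <= m)%N ->
        ~ (exists (G : {mpoly R[i][3]}) (v : nat),
             fps_val (fps_subst G f) = Some v /\
             (d * (m + b) + 'C(d + 2, 2) <= v <= (d + 1) * m - 1)%N),
      forall d : nat,
        (m%:Z - (b * d + 'C(d + 2, 2))%:Z
           <= (gaps_between (value_set f) (d * m) ((d + 1) * m))%:Z)%R
    & forall k : nat,
        ((m * (k + 1))%:Z - (b * 'C(k + 1, 2))%:Z - 'C(k + 3, 3)%:Z
           <= (genus (value_set f))%:Z)%R].
Proof.
have m0 : (0 < m)%N by lia.
have fin := finite_gaps ha hab hf m0.
split=> [d dm [G [v [Gv /andP[dv vd]]]]|d|k].
- have vd' : (v < d.+1 * m)%N by move: vd; rewrite addn1 mulSn; lia.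
  by apply: (value_gap ha hab hf dm (v := v)); [rewrite dv | exists G].
- have : (size (gap_block m b d) <=
          gaps_between (value_set f) (d * m) ((d + 1) * m))%N.
    apply: size_le_card_fset_set; [exact: finite_setIl | exact: iota_uniq |].
    move=> n /(gap_blockP ha hab hf)[ng /andP[dn nd]]; split=> //=.
    by rewrite addn1 dn ltnW.
  by rewrite size_iota; lia.
- have [s [us sg sk]] := gap_blocks ha hab hf k.+1.
  have : (size s <= genus (value_set f))%N.
    by apply: size_le_card_fset_set => // n /sg[].
  by move: sk; rewrite addn1 addSnnS; lia.
Qed.
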